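(* Let the problem $(\mathcal{P})$: minimize $f(x)$ subject to $x \in M$, $x \in Q$, be weakly Levitin-Polyak well-posed with respect to the infeasibility measure $\varphi$. Then the penalty function $F_c = f + c\varphi$ is globally exact if and only if the following three conditions hold true: 1. $F_c$ has the zero duality gap property, i.e. $\sup_{c \ge 0} \inf_{x \in Q} F_c(x) = f_*$; 2. there exists $c_0 \ge 0$ such that $F_c$ attains a global minimum on $Q$ for any $c \ge c_0$; 3. $F_c$ is uniformly locally exact at globally optimal solutions of $(\mathcal{P})$, that is, $F_c$ is locally exact at every point $x_* \in \operatorname{argmin}(\mathcal{P})$ and there exist $0 < c_* < +\infty$ and $0 < r_* < +\infty$ such that $c_*(x_* ) < c_*$ and $r_*(x_*, c_* ) \ge r_*$ for any $x_* \in \operatorname{argmin}(\mathcal{P})$.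
   Context: $(X,d)$ is a metric space, $M,Q \subset X$ are nonempty, $f \colon X \to \mathbb{R}\cup\{+\infty\}$. The feasible region $\Omega = M \cap Q$ is nonempty and the optimal value $f_* = \inf_{x\in\Omega} f(x)$ is finite; $\operatorname{argmin}(\mathcal{P})$ is the set of globally optimal solutions of $(\mathcal{P})$. Notation: $\operatorname{dist}(x,V) = \inf_{y \in V} d(x,y)$, $B(x,r) = \{y \in X \mid d(x,y) \le r\}$. An infeasibility measure (penalty term) for the constraint $x \in M$ on $Q$ is a function $\varphi \colon X \to [0,+\infty]$ such that for any $x \in Q$ one has $\varphi(x)=0 \iff x \in M$; such a $\varphi$ is fixed, and $F_c(x) = f(x) + c\varphi(x)$, $x\in X$, $c \ge 0$. The penalized problem is: minimize $F_c(x)$ subject to $x \in Q$. $(\mathcal{P})$ is weakly Levitin-Polyak well-posed with respect to $\varphi$ if $\operatorname{argmin}(\mathcal{P}) \neq \emptyset$ and for any sequence $\{x_n\}\subset X$ such that $f(x_n)\to f_*$ and $\varphi(x_n)\to 0$ one has $\operatorname{dist}(x_n,\operatorname{argmin}(\mathcal{P}))\to 0$. $F_c$ is globally exact if there exists $c_* \ge 0$ such that for any $c \ge c_*$ the sets of globally optimal solutions of $(\mathcal{P})$ and of the penalized problem coincide. $F_c$ is locally exact at a locally optimal solution $x_*$ of $(\mathcal{P})$ if there exists $c_* \ge 0$ such that for any $c\ge c_*$ the point $x_*$ is a locally optimal solution of the penalized problem; $c_*(x_* )$ denotes the infimum of all such $c_*$. For such a $c_*$, $r_*(x_*,c_* )$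 (the radius of local exactness) is the supremum of all $r>0$ such that $F_c(x) \ge F_c(x_* )$ for all $x \in B(x_*,r)\cap Q$ and all $c \ge c_*$. *)

(* Defs.v *)
From HB Require Import structures.
From mathcomp Require Import all_boot all_order all_algebra.
From mathcomp Require Import all_classical all_reals all_analysis.

Set Implicit Arguments.
Unset Strict Implicit.
Unset Printing Implicit Defensive.

Import Order.TTheory GRing.Theory Num.Theory.

Local Open Scope classical_set_scope.
Local Open Scope ring_scope.
Local Open Scope ereal_scope.

(* The library's [closed_ball] is the closure of the open ball, which in a
   general metric space can be strictly smaller than this set. *)
Definition cball (R : realType) (X : metricType R) (x : X) (r : R) : set X :=
  [set y | (mdist x y <= r)%R].

Definition dist_set (R : realType) (X : metricType R) (x : X) (V : set X)
  : \bar R := ereal_inf [set (mdist x y)%:E | y in V].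

Definition global_min (R : realType) (X : metricType R)
    (g : X -> \bar R) (S : set X) : set X :=
  [set x | S x /\ forall y, S y -> g x <= g y].

Definition local_min (R : realType) (X : metricType R)
    (g : X -> \bar R) (S : set X) : set X :=
  [set x | S x /\ exists2 r : R, (0 < r)%R &
    forall y, (cball x r `&` S) y -> g x <= g y].

Definition opt_value (R : realType) (X : metricType R)
    (f : X -> \bar R) (M Q : set X) : \bar R := ereal_inf (f @` (M `&` Q)).

Definition argminP (R : realType) (X : metricType R)
    (f : X -> \bar R) (M Q : set X) : set X := global_min f (M `&` Q).

Definition infeasibility_measure (R : realType) (X : metricType R)
    (M Q : set X) (phi : X -> \bar R) : Prop :=
  (forall x, 0 <= phi x) /\ (forall x, Q x -> (phi x = 0 <-> M x)).

(* At [c = 0] the convention [0 * +oo = 0] of [\bar R] gives [F_0 = f]. *)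
Definition penalty (R : realType) (X : metricType R)
    (f phi : X -> \bar R) (c : R) (x : X) : \bar R := f x + c%:E * phi x.

Definition weakly_LP_well_posed (R : realType) (X : metricType R)
    (f : X -> \bar R) (M Q : set X) (phi : X -> \bar R) : Prop :=
  argminP f M Q !=set0 /\
  forall u : nat -> X,
    f (u n) @[n --> \oo] --> opt_value f M Q ->
    phi (u n) @[n --> \oo] --> 0 ->
    dist_set (u n) (argminP f M Q) @[n --> \oo] --> 0.

Definition globally_exact (R : realType) (X : metricType R)
    (f : X -> \bar R) (M Q : set X) (phi : X -> \bar R) : Prop :=
  exists2 c0 : R, (0 <= c0)%R &
    forall c : R, (c0 <= c)%R ->
      argminP f M Q = global_min (penalty f phi c) Q.

Definition local_exactness_params (R : realType) (X : metricType R)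
    (f : X -> \bar R) (Q : set X) (phi : X -> \bar R) (x : X) : set R :=
  [set c0 | (0 <= c0)%R /\
    forall c : R, (c0 <= c)%R -> local_min (penalty f phi c) Q x].

Definition locally_exact (R : realType) (X : metricType R)
    (f : X -> \bar R) (M Q : set X) (phi : X -> \bar R) (x : X) : Prop :=
  local_min f (M `&` Q) x /\ local_exactness_params f Q phi x !=set0.

Definition least_local_param (R : realType) (X : metricType R)
    (f : X -> \bar R) (Q : set X) (phi : X -> \bar R) (x : X) : \bar R :=
  ereal_inf (EFin @` local_exactness_params f Q phi x).

Definition local_exactness_radius (R : realType) (X : metricType R)
    (f : X -> \bar R) (Q : set X) (phi : X -> \bar R) (x : X) (c0 : R)
  : \bar R :=
  ereal_sup [set r%:E | r in [set r : R | (0 < r)%R /\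
    forall y, (cball x r `&` Q) y ->
    forall c : R, (c0 <= c)%R -> penalty f phi c x <= penalty f phi c y]].

Definition zero_duality_gap (R : realType) (X : metricType R)
    (f : X -> \bar R) (M Q : set X) (phi : X -> \bar R) : Prop :=
  ereal_sup [set ereal_inf (penalty f phi c @` Q) | c in [set c : R | (0 <= c)%R]]
  = opt_value f M Q.

Definition uniformly_locally_exact (R : realType) (X : metricType R)
    (f : X -> \bar R) (M Q : set X) (phi : X -> \bar R) : Prop :=
  (forall x, argminP f M Q x -> locally_exact f M Q phi x) /\
  exists c0 r0 : R, [/\ (0 < c0)%R, (0 < r0)%R &
    forall x, argminP f M Q x ->
      least_local_param f Q phi x < c0%:E /\
      r0%:E <= local_exactness_radius f Q phi x c0].

(* Main.v *)
Require Import Defs.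
From HB Require Import structures.
From mathcomp Require Import all_boot all_order all_algebra.
From mathcomp Require Import all_classical all_reals all_analysis.
From mathcomp Require Import lra.

Set Implicit Arguments.
Unset Strict Implicit.
Unset Printing Implicit Defensive.

Import Order.TTheory GRing.Theory Num.Theory.

Local Open Scope classical_set_scope.
Local Open Scope ring_scope.
Local Open Scope ereal_scope.

(** If [F_c] is not exact, then [inf_Q F_c < f_*] for every [c]. Choose [c_n] with
    [inf_Q F_{c_n} > f_* - 1/(n+1)] (zero duality gap) and [x_n] in [Q] with
    [F_{2 c_n}(x_n) < f_*]. Comparing the values of [F_{c_n}] and [F_{2 c_n}] at [x_n] gives
    [c_n phi(x_n) <= 1/(n+1)], hence [phi(x_n) --> 0] and [f(x_n) --> f_*]. By well-posedness
    [x_n] eventually lies within the uniform radius of local exactness of some optimal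
    solution, which contradicts [F_{2 c_n}(x_n) < f_*]. *)

Section penalty.
Context {R : realType} {X : metricType R}.
Implicit Types (M Q : set X) (f phi : X -> \bar R) (c : R) (x : X).

Lemma le_penalty f phi c c' x :
  0 <= phi x -> (c <= c')%R -> penalty f phi c x <= penalty f phi c' x.
Proof. by move=> p0 cc'; apply: leeD2l; apply: lee_wpmul2r. Qed.

Lemma argminP_opt_value f M Q x : argminP f M Q x -> f x = opt_value f M Q.
Proof.
move=> [Mx xmin]; apply/eqP; rewrite eq_le; apply/andP; split.
  by apply/ereal_infP => _ [y My <-]; exact: xmin.
by apply: ereal_inf_lbound; exists x.
Qed.

Lemma penalty_argminP f M Q phi c x :
  infeasibility_measure M Q phi -> argminP f M Q x ->
  penalty f phi c x = opt_value f M Q.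
Proof.
move=> [_ phi0] Ax; have [[Mx Qx] _] := Ax.
by rewrite /penalty (phi0 x Qx).2// mule0 adde0; exact: argminP_opt_value.
Qed.

(* The bound is needed at [c1] but exactness is obtained only beyond [c1]: at [c1] itself
   infeasible points may also attain the value [f_*]. *)
Lemma globally_exact_of_lower_bound f M Q phi c1 :
  (forall x, f x != -oo) -> opt_value f M Q \is a fin_num ->
  infeasibility_measure M Q phi -> argminP f M Q !=set0 -> (0 <= c1)%R ->
  (forall x, Q x -> opt_value f M Q <= penalty f phi c1 x) ->
  globally_exact f M Q phi.
Proof.
move=> fNy optfin phiP [a Aa] c10 lb; have [phi_ge0 phi0] := phiP.
exists (c1 + 1)%R => [|c c1c]; first by lra.
have c1c' : (c1 < c)%R by lra.
apply/seteqP; split=> x.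
  move=> Ax; split=> [|y Qy]; first by have [[]] := Ax.
  rewrite (penalty_argminP c phiP Ax); apply: le_trans (lb y Qy) _.
  by apply: le_penalty; [exact: phi_ge0|exact: ltW].
move=> [Qx xmin].
have Fx : penalty f phi c x <= opt_value f M Q.
  by rewrite -(penalty_argminP c phiP Aa); apply: xmin; have [[]] := Aa.
(* Since [F_c(x) <= f_* <= F_{c1}(x)], one gets [(c - c1) * phi x <= 0] with [c1 < c]. An infinite
   [f x] or [phi x] would make [F_c(x)] infinite, above the finite [f_*]. *)
have phix0 : phi x = 0.
  move: Fx (lb x Qx) (phi_ge0 x) (fNy x); rewrite /penalty.
  case: (opt_value f M Q) optfin => [m||]// _.
  case: (f x) => [u||]//; last first.
    rewrite addye ?leye_eq//.
    by move: (phi_ge0 x); case: (phi x) => [p| |] //= _; rewrite gt0_muley// lte_fin; lra.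
  case: (phi x) => [p||]//; last by rewrite gt0_muley ?lte_fin; [rewrite addey// leye_eq|lra].
  rewrite -!EFinM -!EFinD !lee_fin => h1 h2 p0 _.
  by congr EFin; apply/eqP; rewrite eq_le p0 andbT; nra.
split=> [|y [My Qy]]; first by split=> //; apply/(phi0 x Qx).
move: Fx; rewrite /penalty phix0 mule0 adde0 => /le_trans; apply.
by apply: ereal_inf_lbound; exists y.
Qed.

(** The two bounds differ by [c * phi x], which is therefore less than [d]; [1 <= c] passes this on
    to [phi x]. Removing [c * phi x] from [F_c(x)] costs a second [d], hence [m - 2 * d]. *)
Lemma penalty_gap_near_optimal f phi c (m d : R) x :
  f x != -oo -> 0 <= phi x -> (1 <= c)%R ->
  (m - d)%:E <= penalty f phi c x -> penalty f phi (2 * c) x < m%:E ->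
  (m - 2 * d)%:E <= f x <= m%:E /\ phi x <= d%:E.
Proof.
rewrite /penalty => fNy phi0 c1 Fc F2c.
have c20 : (0 < 2 * c)%R by lra.
case: (phi x) phi0 Fc F2c => [p||]//; last first.
  rewrite [(2 * c)%:E * _]gt0_muley ?lte_fin// addey//.
rewrite lee_fin; case: (f x) fNy => [u||]// _ p0.
rewrite -!EFinM -!EFinD !lee_fin lte_fin => Fc F2c.
have pcp : (p <= c * p)%R by apply: ler_peMl.
by split; [apply/andP; split|]; lra.
Qed.

(** At an optimal solution [F_c] equals [f_*] for every [c], so no infimum exceeds [f_*]; exactness
    at [c0] makes one of them reach it. *)
Lemma globally_exact_zero_duality_gap f M Q phi :
  infeasibility_measure M Q phi -> argminP f M Q !=set0 ->
  globally_exact f M Q phi -> zero_duality_gap f M Q phi.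
Proof.
move=> phiP [a Aa] [c0 c00 minE]; have [[Ma Qa] _] := Aa.
apply/eqP; rewrite eq_le; apply/andP; split.
  apply/ereal_supP => _ [c _ <-]; rewrite -(penalty_argminP c phiP Aa).
  by apply: ereal_inf_lbound; exists a.
apply: (@le_trans _ _ (ereal_inf (penalty f phi c0 @` Q))).
  apply/ereal_infP => _ [y Qy <-]; rewrite -(penalty_argminP c0 phiP Aa).
  by move: Aa; rewrite (minE c0)// => -[_]; apply.
by apply: ereal_sup_ubound; exists c0.
Qed.

Lemma globally_exact_uniformly_locally_exact f M Q phi :
  globally_exact f M Q phi -> uniformly_locally_exact f M Q phi.
Proof.
move=> [c0 c00 minE].
have params x : argminP f M Q x -> local_exactness_params f Q phi x c0.
  move=> Ax; split=> // c c0c; move: Ax; rewrite (minE c)// => -[Qx xmin].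
  by split=> //; exists 1%R => // y [_ Qy]; exact: xmin.
split=> [x Ax|].
  split; last by exists c0; exact: params.
  by have [Mx xmin] := Ax; split=> //; exists 1%R => // y [_ My]; exact: xmin.
(* The shift by 1 gives positivity and the strict bound on the least parameter; the radius is
   arbitrary because the minima are global. *)
exists (c0 + 1)%R, 1%R; split=> [||x Ax]; [lra|lra|split].
  apply: (@le_lt_trans _ _ c0%:E); last by rewrite lte_fin; lra.
  by apply: ereal_inf_lbound; exists c0 => //; exact: params.
apply: ereal_sup_ubound; exists 1%R => //; split=> // y [_ Qy] c c0c.
move: Ax; rewrite (minE c); last by lra.
by move=> -[_]; apply.
Qed.

Lemma zero_duality_gap_lower_bound f M Q phi c0 (d : R) :
  (forall x, 0 <= phi x) -> opt_value f M Q \is a fin_num ->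
  zero_duality_gap f M Q phi -> (0 < d)%R ->
  exists2 c, (c0 <= c)%R &
    forall x, Q x -> (fine (opt_value f M Q) - d)%:E <= penalty f phi c x.
Proof.
move=> phi_ge0 optfin gap d0.
have := optfin; rewrite -[X in X \is a _]gap => /(ub_ereal_sup_adherent d0)[_ [c _ <-]].
rewrite gap -(fineK optfin) -EFinB => lt_inf.
(* Raising [c] above [c0] keeps the bound because [F_c] is nondecreasing in [c]. *)
exists (Num.max c0 c) => [|x Qx]; first by rewrite le_max lexx.
apply: (@le_trans _ _ (penalty f phi c x)); last first.
  by apply: le_penalty => //; rewrite le_max lexx orbT.
apply: ltW; apply: lt_le_trans lt_inf _.
by apply: ereal_inf_lbound; exists x.
Qed.

(** The radius of local exactness is a supremum that may not be attained; the strict inequality on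
    [mdist x y] yields an admissible radius beyond it. *)
Lemma penalty_lower_bound_near_argminP f M Q phi c0 (r0 : R) x y c :
  infeasibility_measure M Q phi -> argminP f M Q y ->
  r0%:E <= local_exactness_radius f Q phi y c0 ->
  (mdist x y < r0)%R -> Q x -> (c0 <= c)%R ->
  opt_value f M Q <= penalty f phi c x.
Proof.
move=> phiP Ay r0le xyr0 Qx c0c.
have : (mdist x y)%:E < local_exactness_radius f Q phi y c0.
  by apply: lt_le_trans r0le; rewrite lte_fin.
move=> /ereal_sup_gt[_ [r [_ rmin] <-]]; rewrite lte_fin => xyr.
rewrite -(penalty_argminP c phiP Ay); apply: rmin => //; split=> //.
by rewrite /cball /= metric_sym ltW.
Qed.

End penalty.

Theorem theorem3 (R : realType) (X : metricType R) (M Q : set X)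
    (f phi : X -> \bar R)
    (M_neq0 : M !=set0) (Q_neq0 : Q !=set0)
    (f_neqNy : forall x, f x != -oo)
    (feasible : M `&` Q !=set0)
    (opt_fin : opt_value f M Q \is a fin_num)
    (phiP : infeasibility_measure M Q phi)
    (wellposed : weakly_LP_well_posed f M Q phi) :
  globally_exact f M Q phi <->
  [/\ zero_duality_gap f M Q phi,
      (exists2 c0 : R, (0 <= c0)%R &
        forall c : R, (c0 <= c)%R -> global_min (penalty f phi c) Q !=set0) &
      uniformly_locally_exact f M Q phi].
Proof.
have [A_neq0 wp] := wellposed; have [phi_ge0 _] := phiP.
split=> [ge|[gap _ [_ [c0 [r0 [c00 r00 unif]]]]]].
  split; [exact: globally_exact_zero_duality_gap| |exact: globally_exact_uniformly_locally_exact].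
  have [c0 c00 minE] := ge.
  by exists c0 => // c c0c; rewrite -minE.
apply: contrapT => not_exact.
have below c : (0 <= c)%R -> exists2 x, Q x & penalty f phi c x < opt_value f M Q.
  move=> c_ge0; apply: contrapT => nox; apply: not_exact.
  apply: (globally_exact_of_lower_bound f_neqNy opt_fin phiP A_neq0 c_ge0) => x Qx.
  by rewrite leNgt; apply/negP => Fx; apply: nox; exists x.
set m := fine (opt_value f M Q); have optE : opt_value f M Q = m%:E by rewrite fineK.
have /choice[u uP] (n : nat) : exists x, [/\ Q x,
    exists2 c, (c0 <= c)%R & penalty f phi c x < opt_value f M Q,
    (m - 2 * harmonic n)%:E <= f x <= m%:E & phi x <= (harmonic n)%:E].
  (* [1 <= c] serves the comparison of [F_c] with [F_{2c}]; [c0 <= c] keeps [2 * c] in the range of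
     uniform local exactness. *)
  have [c c0c lb] := zero_duality_gap_lower_bound (Num.max c0 1%R)
    phi_ge0 opt_fin gap (harmonic_gt0 n).
  move: c0c; rewrite ge_max => /andP[c0c c1].
  have [|x Qx Fx] := below (2 * c)%R; first by lra.
  have Fx' : penalty f phi (2 * c) x < m%:E by rewrite -optE.
  have [? ?] := penalty_gap_near_optimal (f_neqNy x) (phi_ge0 x) c1 (lb x Qx) Fx'.
  by exists x; split=> //; exists (2 * c)%R => //; lra.
have fu : f (u n) @[n --> \oo] --> opt_value f M Q.
  rewrite optE; apply: (@squeeze_cvge _ _ _ _ (fun n => (m - 2 * harmonic n)%:E) _
    (fun=> m%:E)); last exact: cvg_cst.
    by near=> n; have [] := uP n.
  apply: cvg_EFin; first by near=> n.
  have : (m - 2 * harmonic n)%R @[n --> \oo] --> (m - 2 * 0)%R.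
    by apply: cvgB; [exact: cvg_cst|apply: cvgMl_tmp; exact: cvg_harmonic].
  by rewrite mulr0 subr0.
have phiu : phi (u n) @[n --> \oo] --> 0.
  apply: (@squeeze_cvge _ _ _ _ (fun=> 0) _ (fun n => (harmonic n)%:E)).
  - by near=> n; have [_ _ _ ->] := uP n; rewrite phi_ge0.
  - exact: cvg_cst.
  - by apply: cvg_EFin; [near=> n|exact: cvg_harmonic].
have near0 : nbhs (0 : \bar R) [set e | e < r0%:E].
  by apply: open_ereal_lt'; rewrite lte_fin.
have un_near : \forall n \near \oo, dist_set (u n) (argminP f M Q) < r0%:E.
  exact: wp u fu phiu _ near0.
have [n un_lt] := filter_ex un_near.
(* A distance strictly below [r0] gives an optimal [y] within [r0], even if no nearest one
   exists. *)
have [_ [y Ay <-]] := ereal_inf_lt un_lt; rewrite lte_fin => uyr0.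
have [Qu [c c0c]] := uP n; rewrite ltNge => /negP + _ _; apply.
exact: penalty_lower_bound_near_argminP phiP Ay (unif y Ay).2 uyr0 Qu c0c.
Unshelve. all: by end_near.
Qed.
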